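(* Let $s\neq 0$ be real. The Kepler system in the plane $\mathbb{C}$ with the flat metric and force function $\frac{s}{|q|}$, with all energies in $\mathbb{R}$ allowed, admits any focused conic section, degenerate cases allowed, as an integrable reflection wall. These include: (1) any focused parabola; (2) any focused ellipse; (3) any focused hyperbola; (4) any line. The additional first integral is $$A(p_1,p_2,q_1,q_2)=(p_1q_2-p_2q_1)^2-2\tilde a\left((-p_1q_2+p_2q_1)p_2-\frac{s\,q_1}{\sqrt{q_1^2+q_2^2}}\right),\qquad \tilde a=\frac{a^2e^2}{2},$$ where $a$ and $e$ are the semi-axis and the eccentricity of the centered conic section in the $z$-plane which corresponds to the wall under the complex square mapping $z\mapsto q=z^2$.
   Context: The Kepler system has Hamiltonian (energy) $E=\frac{|p|^2}{2}-\frac{s}{|q|}$, $q=(q_1,q_2)$ (identified with $q_1+iq_2\in\mathbb{C}$), $p=(p_1,p_2)$; the parameter $s$ may have either sign (attractive or repulsive). A conic section is called focused when the origin is a focus of it, and centered when its center is at the origin. Up to rotation, the centered conic section is written $\frac{z_1^2}{a^2}+\frac{z_2^2}{b^2}=1$ with $a\ge b$ (then $a^2e^2=a^2-b^2$) or $\frac{z_1^2}{a^2}-\frac{z_2^2}{b^2}=1$ (then $a^2e^2=a^2+b^2$), where $z=z_1+iz_2$. When the wall is a focused ellipse or hyperbola, $\tilde a$ is the distance from its center to one of its foci. A curve $\mathcal{B}$ is an integrable reflection wall for the system if the mechanical billiard, in which the particle moves according to the system and is reflected elastically at $\mathcal{B}$ (tangential component of the momentum kept, normal component reversed), possesses for every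 energy $e_0\in\mathbb{R}$ an additional non-trivial first integral on $\{E=e_0\}$, independent of $E$, preserved by the motion and by the reflections. It is not required that the billiard mapping be always well-defined.
   Formalization: For a focused parabola the corresponding conic in the z-plane is a pair of parallel lines, so ã is infinite and A undefined; there the integral given is the limit of A/(-2ã), the Laplace component along the axis of the parabola. *)

(* Defs.v *)
(* Stdlib real numbers with Coquelicot. *)
From Stdlib Require Import Reals.
From Coquelicot Require Import Coquelicot.
Open Scope R_scope.

(** * The Kepler system in the plane [C = R * R] *)

Definition dot (x y : C) : R := fst x * fst y + snd x * snd y.

Definition energy (s : R) (p q : C) : R := Cmod p ^ 2 / 2 - s / Cmod q.

Definition d_p1 (F : C -> C -> R) (p q : C) : R :=
  Derive (fun x => F (x, snd p) q) (fst p).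
Definition d_p2 (F : C -> C -> R) (p q : C) : R :=
  Derive (fun x => F (fst p, x) q) (snd p).
Definition d_q1 (F : C -> C -> R) (p q : C) : R :=
  Derive (fun x => F p (x, snd q)) (fst q).
Definition d_q2 (F : C -> C -> R) (p q : C) : R :=
  Derive (fun x => F p (fst q, x)) (snd q).

(** Hamilton's equations on the time interval [(t0, t1)], away from the
    collision [q = 0]. *)
Definition kepler_motion (s t0 t1 : R) (p q : R -> C) : Prop :=
  forall t, t0 < t < t1 ->
    q t <> RtoC 0 /\
    is_derive (fun r => fst (q r)) t (d_p1 (energy s) (p t) (q t)) /\
    is_derive (fun r => snd (q r)) t (d_p2 (energy s) (p t) (q t)) /\
    is_derive (fun r => fst (p r)) t (- d_q1 (energy s) (p t) (q t)) /\
    is_derive (fun r => snd (p r)) t (- d_q2 (energy s) (p t) (q t)).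

(** * Elastic reflection at a wall *)

(** [v] is the nonzero velocity at [q] of some curve running in [B]. *)
Definition tangent (B : C -> Prop) (q v : C) : Prop :=
  v <> RtoC 0 /\
  exists c : R -> C,
    c 0 = q /\
    locally 0 (fun t => B (c t)) /\
    is_derive (fun t => fst (c t)) 0 (fst v) /\
    is_derive (fun t => snd (c t)) 0 (snd v).

(** [Ci * v] is normal to [B] when [v] is tangent to it. *)
Definition reflected (B : C -> Prop) (q p p' : C) : Prop :=
  B q /\
  exists v : C,
    tangent B q v /\
    dot p' v = dot p v /\
    dot p' (Ci * v)%C = - dot p (Ci * v)%C.

(** * Additional first integrals *)

Definition C1_phase_space (F : C -> C -> R) : Prop :=
  forall p q : C, q <> RtoC 0 ->
    (ex_derive (fun x => F (x, snd p) q) (fst p) /\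
     ex_derive (fun x => F (fst p, x) q) (snd p) /\
     ex_derive (fun x => F p (x, snd q)) (fst q) /\
     ex_derive (fun x => F p (fst q, x)) (snd q)) /\
    (continuous (fun x : C * C => d_p1 F (fst x) (snd x)) (p, q) /\
     continuous (fun x : C * C => d_p2 F (fst x) (snd x)) (p, q) /\
     continuous (fun x : C * C => d_q1 F (fst x) (snd x)) (p, q) /\
     continuous (fun x : C * C => d_q2 F (fst x) (snd x)) (p, q)).

(** Linear independence of the differentials of [F] and [G]. *)
Definition independent_at (F G : C -> C -> R) (p q : C) : Prop :=
  forall x y : R,
    x * d_p1 F p q + y * d_p1 G p q = 0 ->
    x * d_p2 F p q + y * d_p2 G p q = 0 ->
    x * d_q1 F p q + y * d_q1 G p q = 0 ->
    x * d_q2 F p q + y * d_q2 G p q = 0 ->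
    x = 0 /\ y = 0.

(** Independence is asked on a dense (and, [F] being C1, open) subset of the
    level set; for [s < 0] and [e0 <= 0] the level set is empty. *)
Definition independent_on_level (s e0 : R) (F : C -> C -> R) : Prop :=
  forall p q : C, q <> RtoC 0 -> energy s p q = e0 ->
  forall eps : R, 0 < eps ->
  exists p' q' : C,
    q' <> RtoC 0 /\ energy s p' q' = e0 /\
    Cmod (p' - p)%C < eps /\ Cmod (q' - q)%C < eps /\
    independent_at F (energy s) p' q'.

Definition additional_first_integral
    (s e0 : R) (B : C -> Prop) (F : C -> C -> R) : Prop :=
  C1_phase_space F /\
  independent_on_level s e0 F /\
  (forall (t0 t1 : R) (p q : R -> C),
     kepler_motion s t0 t1 p q ->
     (forall t, t0 < t < t1 -> energy s (p t) (q t) = e0) ->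
     forall t t', t0 < t < t1 -> t0 < t' < t1 ->
       F (p t) (q t) = F (p t') (q t')) /\
  (forall p q p' : C,
     q <> RtoC 0 -> energy s p q = e0 -> reflected B q p p' ->
     F p' q = F p q).

Definition integrable_reflection_wall (s : R) (B : C -> Prop) : Prop :=
  forall e0 : R, exists F : C -> C -> R, additional_first_integral s e0 B F.

(** * Focused conic sections *)

(** Foci [0] and [f], major axis [2 * k]. *)
Definition ellipse (f : C) (k : R) (q : C) : Prop :=
  Cmod q + Cmod (q - f)%C = 2 * k.

(** Both branches; foci [0] and [f], transverse axis [2 * k]. *)
Definition hyperbola (f : C) (k : R) (q : C) : Prop :=
  Rabs (Cmod q - Cmod (q - f)%C) = 2 * k.

Definition line (u : C) (d : R) (q : C) : Prop := dot u q = d.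

(** Focus [0] and directrix [line u d], for a unit vector [u]. *)
Definition parabola (u : C) (d : R) (q : C) : Prop :=
  Cmod q = Rabs (dot u q - d).

(** The closed parameter ranges include the degenerate cases: the segment
    [[0, f]] ([Cmod f = 2 * k]) for ellipses; the perpendicular bisector of
    [[0, f]] ([k = 0]) and the two rays of the focal axis outside [[0, f]]
    ([2 * k = Cmod f]) for hyperbolas; the axis ([d = 0]) for parabolas.
    A pair of lines through the origin is a hyperbola whose foci have merged. *)
Inductive focused_conic : (C -> Prop) -> Prop :=
| focused_parabola u d :
    Cmod u = 1 -> focused_conic (parabola u d)
| focused_ellipse f k :
    0 < k -> Cmod f <= 2 * k -> focused_conic (ellipse f k)
| focused_hyperbola f k :
    f <> RtoC 0 -> 0 <= 2 * k <= Cmod f -> focused_conic (hyperbola f k)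
| focused_line u d :
    Cmod u = 1 -> focused_conic (line u d)
| focused_line_pair u w :
    Cmod u = 1 -> Cmod w = 1 ->
    focused_conic (fun q => line u 0 q \/ line w 0 q).

(** * Centered conic sections and the complex square mapping *)

(** [v] is the unit vector of the [a]-axis. *)
Definition centered_ellipse (a b : R) (v z : C) : Prop :=
  let w := (Cconj v * z)%C in fst w ^ 2 / a ^ 2 + snd w ^ 2 / b ^ 2 = 1.
Definition centered_hyperbola (a b : R) (v z : C) : Prop :=
  let w := (Cconj v * z)%C in fst w ^ 2 / a ^ 2 - snd w ^ 2 / b ^ 2 = 1.
Definition centered_asymptotes (a b : R) (v z : C) : Prop :=
  let w := (Cconj v * z)%C in fst w ^ 2 / a ^ 2 - snd w ^ 2 / b ^ 2 = 0.

Definition ellipse_ecc (a b : R) : R := sqrt (1 - b ^ 2 / a ^ 2).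
Definition hyperbola_ecc (a b : R) : R := sqrt (1 + b ^ 2 / a ^ 2).

Definition square_image (Z : C -> Prop) (q : C) : Prop :=
  exists z : C, Z z /\ q = (z * z)%C.

(** [corresponds B ta u]: the wall [B] is the image under [z |-> z * z] of a
    centered conic section with [a ^ 2 * e ^ 2 / 2 = ta], whose [a]-axis is
    mapped to the direction [u]. A centered hyperbola is mapped (two to one) to
    a single branch; the other branch of the same focused hyperbola comes from
    exchanging [a] and [b], which does not change [a ^ 2 * e ^ 2]. A degenerate
    hyperbola consisting of its asymptotes has semi-axis zero, whence
    [ta = 0]. *)
Inductive corresponds (B : C -> Prop) : R -> C -> Prop :=
| corresponds_ellipse a b v :
    0 < b <= a -> Cmod v = 1 ->
    (forall q, B q <-> square_image (centered_ellipse a b v) q) ->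
    corresponds B (a ^ 2 * ellipse_ecc a b ^ 2 / 2) (v * v)%C
| corresponds_branch a b v :
    0 < a -> 0 < b -> Cmod v = 1 ->
    (forall q, B q <-> square_image (centered_hyperbola a b v) q) ->
    corresponds B (a ^ 2 * hyperbola_ecc a b ^ 2 / 2) (v * v)%C
| corresponds_hyperbola a b v :
    0 < a -> 0 < b -> Cmod v = 1 ->
    (forall q, B q <-> square_image (centered_hyperbola a b v) q \/
                       square_image (centered_hyperbola b a v) q) ->
    corresponds B (a ^ 2 * hyperbola_ecc a b ^ 2 / 2) (v * v)%C
| corresponds_asymptotes a b v :
    0 < a -> 0 < b -> Cmod v = 1 ->
    (forall q, B q <-> square_image (centered_asymptotes a b v) q) ->
    corresponds B 0 (v * v)%C.

(** * The explicit first integrals *)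

Definition laplace (s p1 p2 q1 q2 : R) : R :=
  (- p1 * q2 + p2 * q1) * p2 - s * q1 / sqrt (q1 ^ 2 + q2 ^ 2).

Definition A (s ta p1 p2 q1 q2 : R) : R :=
  (p1 * q2 - p2 * q1) ^ 2 - 2 * ta * laplace s p1 p2 q1 q2.

(** [F] written in the coordinates whose first axis is directed by the unit
    vector [u]. *)
Definition rotated (u : C) (F : R -> R -> R -> R -> R) (p q : C) : R :=
  let p' := (Cconj u * p)%C in
  let q' := (Cconj u * q)%C in
  F (fst p') (snd p') (fst q') (snd q').

(* Main.v *)
(* Write [L q p] for the cross product of [q] and [p]. All the first integrals
   have the form [al * L q p ^ 2 + L q p * L w p - s * dot w q / Cmod q]: the
   squared angular momentum and the component along [w] of the Laplace vector.
   For [al = 1] and [w = - f] the part quadratic in [p] is the product of the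
   angular momenta about the foci [0] and [f]. It is invariant under reflection
   about [v] iff [v ^ 2] is a real multiple of [q * (q - f)], which is the
   optical property of the conics with foci [0] and [f]; the rest depends on
   [q] only.

   Independence from the energy: the minor of the differentials in the momentum
   directions is a quadratic form in [p] which, seen as the imaginary part of
   [conj(c) * p ^ 2] with [c = q * (al * q + w)], is nonzero after a small
   rotation of [p] as soon as [p <> 0] and [c <> 0].

   Under [q = z * z] the squared coordinates of [z] along the axes of a centered
   conic are [(Cmod q + x) / 2] and [(Cmod q - x) / 2], where [x] is a coordinate
   of [q], so that the image satisfies an equation affine in [Cmod q] and [x]. *)
Require Import Defs.
From Stdlib Require Import Reals Lra Psatz FunctionalExtensionality.
From Coquelicot Require Import Coquelicot.
Open Scope R_scope.

(** * The common family of first integrals *)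

Definition cross (x y : C) : R := fst x * snd y - snd x * fst y.

Definition fint (s al : R) (w p q : C) : R :=
  al * cross q p ^ 2 + cross q p * cross w p - s * dot w q / Cmod q.

Lemma norm2_pos (q : C) : q <> RtoC 0 -> 0 < fst q ^ 2 + snd q ^ 2.
Proof.
  intros Hq. destruct q as [x y]; simpl.
  destruct (Req_dec x 0) as [->|Hx]; [|nra].
  destruct (Req_dec y 0) as [->|Hy]; [|nra].
  now elim Hq.
Qed.

Lemma Cmod_sq (q : C) : Cmod q ^ 2 = fst q ^ 2 + snd q ^ 2.
Proof.
  unfold Cmod. rewrite pow2_sqrt; [easy|nra].
Qed.

Ltac unf := unfold fint, energy, cross, dot, Cmod; simpl fst; simpl snd.

(** * The first integrals along the Kepler flow *)

Lemma der_energy (s : R) (p q : C) : q <> RtoC 0 ->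
  d_p1 (energy s) p q = fst p /\ d_p2 (energy s) p q = snd p /\
  d_q1 (energy s) p q = s * fst q / Cmod q ^ 3 /\
  d_q2 (energy s) p q = s * snd q / Cmod q ^ 3.
Proof.
  intros Hq%norm2_pos. destruct p as [p1 p2], q as [q1 q2]. simpl fst in *; simpl snd in *.
  assert (Hr : sqrt (q1 ^ 2 + q2 ^ 2) <> 0) by (apply Rgt_not_eq, sqrt_lt_R0; lra).
  assert (Hs : sqrt (q1 ^ 2 + q2 ^ 2) ^ 2 = q1 ^ 2 + q2 ^ 2) by (apply pow2_sqrt; lra).
  unfold d_p1, d_p2, d_q1, d_q2.
  (* At [p = 0] the norm [Cmod p] is not differentiable, so its square is expanded before
     differentiating. *)
  assert (E : forall (x y : R) (z : C), energy s (x, y) z = (x ^ 2 + y ^ 2) / 2 - s / Cmod z).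
  { intros. unfold energy. now rewrite Cmod_sq. }
  repeat split; apply is_derive_unique; simpl fst; simpl snd.
  - apply is_derive_ext with (fun x => (x ^ 2 + p2 ^ 2) / 2 - s / Cmod (q1, q2)); [intro; symmetry; apply E|].
    auto_derive; [easy|]. field.
  - apply is_derive_ext with (fun x => (p1 ^ 2 + x ^ 2) / 2 - s / Cmod (q1, q2)); [intro; symmetry; apply E|].
    auto_derive; [easy|]. field.
  - unf. auto_derive.
    + simpl in *. repeat split; auto; try lra.
    + simpl. simpl in Hr. field; auto.
  - unf. auto_derive.
    + simpl in *. repeat split; auto; try lra.
    + simpl. simpl in Hr. field; auto.
Qed.

Lemma der_fint (s al : R) (w p q : C) : q <> RtoC 0 ->
  is_derive (fun x => fint s al w (x, snd p) q) (fst p)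
    (- snd q * (2 * al * cross q p + cross w p) - cross q p * snd w) /\
  is_derive (fun x => fint s al w (fst p, x) q) (snd p)
    (fst q * (2 * al * cross q p + cross w p) + cross q p * fst w) /\
  is_derive (fun x => fint s al w p (x, snd q)) (fst q)
    (snd p * (2 * al * cross q p + cross w p)
     - s * (fst w / Cmod q - dot w q * fst q / Cmod q ^ 3)) /\
  is_derive (fun x => fint s al w p (fst q, x)) (snd q)
    (- fst p * (2 * al * cross q p + cross w p)
     - s * (snd w / Cmod q - dot w q * snd q / Cmod q ^ 3)).
Proof.
  intros Hq%norm2_pos. destruct p as [p1 p2], q as [q1 q2]. simpl fst in *; simpl snd in *.
  assert (Hr : sqrt (q1 ^ 2 + q2 ^ 2) <> 0) by (apply Rgt_not_eq, sqrt_lt_R0; lra).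
  refine (conj _ (conj _ (conj _ _))); unf; auto_derive; simpl in *; try (repeat split; auto; lra);
   field; auto.
Qed.

(** The force is central, so [cross q p] is constant. The Lagrange identity for cross products shows
    that [cross q p * cross w p] and [s * dot w q / Cmod q] then have the same rate of change,
    [- s * cross q p * cross w q / Cmod q ^ 3]. *)
Lemma fint_motion (s al : R) (w : C) (t0 t1 : R) (p q : R -> C) :
  kepler_motion s t0 t1 p q ->
  forall t t', t0 < t < t1 -> t0 < t' < t1 ->
    fint s al w (p t) (q t) = fint s al w (p t') (q t').
Proof.
  intros H.
  assert (D : forall t, t0 < t < t1 -> is_derive (fun r => fint s al w (p r) (q r)) t 0).
  { intros t Ht. destruct (H t Ht) as (Hq & H1 & H2 & H3 & H4).
    destruct (der_energy s (p t) (q t) Hq) as (E1 & E2 & E3 & E4).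
    rewrite E1 in H1; rewrite E2 in H2; rewrite E3 in H3; rewrite E4 in H4.
    apply norm2_pos in Hq. clear E1 E2 E3 E4 H.
    revert H1 H2 H3 H4 Hq. unfold fint, cross, dot, Cmod.
    set (a := fun r => fst (q r)); set (b := fun r => snd (q r)).
    set (c := fun r => fst (p r)); set (d := fun r => snd (p r)).
    change (fst (q t)) with (a t); change (snd (q t)) with (b t).
    change (fst (p t)) with (c t); change (snd (p t)) with (d t).
    intros H1 H2 H3 H4 Hq.
    apply is_derive_ext with (fun r => al * (a r * d r - b r * c r) ^ 2 +
      (a r * d r - b r * c r) * (fst w * d r - snd w * c r) -
      s * (fst w * a r + snd w * b r) / sqrt (a r ^ 2 + b r ^ 2)); [easy|].
    assert (Hr : sqrt (a t ^ 2 + b t ^ 2) <> 0) by (apply Rgt_not_eq, sqrt_lt_R0; lra).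
    assert (Hs : sqrt (a t ^ 2 + b t ^ 2) ^ 2 = a t ^ 2 + b t ^ 2) by (apply pow2_sqrt; lra).
    auto_derive.
    - simpl in *. repeat split; try (eexists; eassumption); auto; lra.
    - replace (Derive (fun x => a x) t) with (c t) by (symmetry; now apply is_derive_unique).
      replace (Derive (fun x => b x) t) with (d t) by (symmetry; now apply is_derive_unique).
      replace (Derive (fun x => c x) t) with (- (s * a t / sqrt (a t ^ 2 + b t ^ 2) ^ 3))
        by (symmetry; now apply is_derive_unique).
      replace (Derive (fun x => d x) t) with (- (s * b t / sqrt (a t ^ 2 + b t ^ 2) ^ 3))
        by (symmetry; now apply is_derive_unique).
      simpl in *.
      rewrite !Rmult_1_r in *.
      set (r := sqrt (a t * a t + b t * b t)) in *.
      apply Rmult_eq_reg_r with (r ^ 3); [|now apply pow_nonzero].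
      field_simplify; [|exact Hr].
      replace (r ^ 2) with (a t * a t + b t * b t) by (rewrite <- Hs; ring).
      field. }
  assert (W : forall t t', t < t' -> t0 < t < t1 -> t0 < t' < t1 ->
    fint s al w (p t) (q t) = fint s al w (p t') (q t')).
  { intros t t' Hlt Ht Ht'.
    apply (eq_is_derive (fun r => fint s al w (p r) (q r))); [|easy].
    intros r Hr. apply D. lra. }
  intros t t' Ht Ht'. destruct (Rtotal_order t t') as [L|[->|L]]; auto.
  symmetry; auto.
Qed.

(** * Continuity of the partial derivatives on phase space *)

Lemma cont_plus {U : UniformSpace} (f g : U -> R) (x : U) :
  continuous f x -> continuous g x -> continuous (fun y => f y + g y) x.
Proof. exact (continuous_plus f g x). Qed.

Lemma cont_minus {U : UniformSpace} (f g : U -> R) (x : U) :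
  continuous f x -> continuous g x -> continuous (fun y => f y - g y) x.
Proof. exact (continuous_minus f g x). Qed.

Lemma cont_opp {U : UniformSpace} (f : U -> R) (x : U) :
  continuous f x -> continuous (fun y => - f y) x.
Proof. exact (continuous_opp f x). Qed.

Lemma cont_mult {U : UniformSpace} (f g : U -> R) (x : U) :
  continuous f x -> continuous g x -> continuous (fun y => f y * g y) x.
Proof. exact (continuous_mult f g x). Qed.

Lemma cont_pow {U : UniformSpace} (f : U -> R) (n : nat) (x : U) :
  continuous f x -> continuous (fun y => f y ^ n) x.
Proof.
  intros Hf. induction n as [|n IH]; simpl.
  - apply continuous_const.
  - now apply cont_mult.
Qed.

Lemma cont_div {U : UniformSpace} (f g : U -> R) (x : U) :
  continuous f x -> continuous g x -> g x <> 0 -> continuous (fun y => f y / g y) x.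
Proof.
  intros Hf Hg Hn. apply cont_mult; [easy|].
  now apply (continuous_comp g Rinv); [|apply continuous_Rinv].
Qed.

Lemma cont_Cmod {U : UniformSpace} (c : U -> C) (x : U) :
  continuous (fun y => fst (c y)) x -> continuous (fun y => snd (c y)) x ->
  continuous (fun y => Cmod (c y)) x.
Proof.
  intros H1 H2. unfold Cmod.
  apply (continuous_comp (fun y => fst (c y) ^ 2 + snd (c y) ^ 2) sqrt);
    [|apply continuous_sqrt].
  now apply cont_plus; apply cont_pow.
Qed.

Lemma cont_coordinates (x : C * C) :
  continuous (fun y : C * C => fst (fst y)) x /\ continuous (fun y : C * C => snd (fst y)) x /\
  continuous (fun y : C * C => fst (snd y)) x /\ continuous (fun y : C * C => snd (snd y)) x.
Proof.
  destruct x as [[p1 p2] [q1 q2]].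
  repeat split.
  - apply (continuous_comp (fun y : C * C => fst y) (fun y : C => fst y)); apply continuous_fst.
  - apply (continuous_comp (fun y : C * C => fst y) (fun y : C => snd y));
      [apply continuous_fst|apply continuous_snd].
  - apply (continuous_comp (fun y : C * C => snd y) (fun y : C => fst y));
      [apply continuous_snd|apply continuous_fst].
  - apply (continuous_comp (fun y : C * C => snd y) (fun y : C => snd y)); apply continuous_snd.
Qed.

Lemma locally_nonzero (p q : C) :
  q <> RtoC 0 -> locally (p, q) (fun y : C * C => snd y <> RtoC 0).
Proof.
  intros Hq. destruct (cont_coordinates (p, q)) as (_ & _ & H1 & H2).
  assert (H := cont_Cmod (fun y : C * C => snd y) (p, q) H1 H2).
  apply filter_imp with (fun y : C * C => Cmod (snd y) <> 0).
  - intros y Hy E. apply Hy. now rewrite E, Cmod_0.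
  - apply (H (fun u => u <> 0)), (open_neq 0). apply Rgt_not_eq. now apply Cmod_gt_0.
Qed.

Lemma fint_C1 (s al : R) (w : C) : C1_phase_space (fint s al w).
Proof.
  intros p q Hq.
  destruct (der_fint s al w p q Hq) as (H1 & H2 & H3 & H4).
  destruct (cont_coordinates (p, q)) as (C1 & C2 & C3 & C4).
  (* The formulas for the partial derivatives hold only off the collision [q = 0]; this set is a
     neighbourhood of [(p, q)], which is enough to transfer continuity. *)
  assert (Hc : forall (D : C -> C -> R) f,
    (forall p q, q <> RtoC 0 -> D p q = f p q) ->
    continuous (fun x : C * C => f (fst x) (snd x)) (p, q) ->
    continuous (fun x : C * C => D (fst x) (snd x)) (p, q)).
  { intros D f Df. apply continuous_ext_loc.
    apply filter_imp with (2 := locally_nonzero p q Hq).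
    intros y Hy. now rewrite Df. }
  assert (Hr : Cmod q <> 0) by now apply Rgt_not_eq, Cmod_gt_0.
  split.
  - refine (conj _ (conj _ (conj _ _))); eexists; eassumption.
  - refine (conj _ (conj _ (conj _ _))); (eapply Hc;
      [intros p' q' Hq'; apply is_derive_unique, (der_fint s al w p' q' Hq')
      |]); unfold cross, dot;
    repeat match goal with
    | |- continuous (fun x => fst (fst x)) _ => exact C1
    | |- continuous (fun x => snd (fst x)) _ => exact C2
    | |- continuous (fun x => fst (snd x)) _ => exact C3
    | |- continuous (fun x => snd (snd x)) _ => exact C4
    | |- continuous (fun _ => _ + _) _ => apply cont_plus
    | |- continuous (fun _ => _ - _) _ => apply cont_minus
    | |- continuous (fun _ => - _) _ => apply cont_opp
    | |- continuous (fun _ => _ * _) _ => apply cont_mult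
    | |- continuous (fun _ => _ / _) _ => apply cont_div
    | |- continuous (fun _ => _ ^ _) _ => apply cont_pow
    | |- continuous (fun _ => Cmod _) _ => apply cont_Cmod
    | |- continuous _ _ => apply continuous_const
    | |- _ => first [exact Hr | now apply pow_nonzero]
    end.
Qed.

(** * Independence of the energy *)

(* [E_p1 * F_p2 - E_p2 * F_p1] for [F = fint s al w] and [E = energy s]. *)
Definition minor (al : R) (w q p : C) : R :=
  let k := (q * (RtoC al * q + w))%C in
  fst k * (2 * fst p * snd p) - snd k * (fst p ^ 2 - snd p ^ 2).

(** Eliminating [y] from the two momentum components gives [x * minor = 0]. Then [y] times [p]
    vanishes, and [p = 0] is excluded because it would make the minor vanish. *)
Lemma independent_of_minor (s al : R) (w p q : C) :
  q <> RtoC 0 -> minor al w q p <> 0 -> independent_at (fint s al w) (energy s) p q.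
Proof.
  intros Hq Hm x y.
  destruct (der_energy s p q Hq) as (-> & -> & _).
  destruct (der_fint s al w p q Hq) as (E1 & E2 & _).
  unfold d_p1, d_p2.
  replace (Derive _ (fst p)) with (- snd q * (2 * al * cross q p + cross w p) - cross q p * snd w)
    by (symmetry; now apply is_derive_unique).
  replace (Derive _ (snd p)) with (fst q * (2 * al * cross q p + cross w p) + cross q p * fst w)
    by (symmetry; now apply is_derive_unique).
  intros H1 H2 _ _.
  assert (Hx : x * minor al w q p = 0).
  { unfold minor, cross, RtoC in *; simpl in *.
    match type of H1 with ?a = 0 => match type of H2 with ?b = 0 =>
      transitivity (b * fst p - a * snd p); [ring|rewrite H1, H2; ring] end end. }
  assert (x = 0) as -> by (destruct (Rmult_integral _ _ Hx); tauto).
  split; [easy|].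
  destruct (Req_dec y 0) as [|Hy]; [easy|].
  elim Hm. unfold minor.
  assert (fst p = 0) as -> by nra. assert (snd p = 0) as -> by nra. ring.
Qed.

Lemma Cmod_scal (t : R) (z : C) : 0 <= t -> Cmod (RtoC t * z)%C = t * Cmod z.
Proof. intros Ht. now rewrite Cmod_mult, Cmod_R, Rabs_pos_eq. Qed.

Lemma unit_direction (p : C) : exists w : C, Cmod w = 1 /\ p = (RtoC (Cmod p) * w)%C.
Proof.
  destruct (Req_dec (Cmod p) 0) as [E|E].
  - exists (RtoC 1). rewrite Cmod_1, E. split; [easy|].
    apply Cmod_eq_0 in E. rewrite E. ring.
  - assert (E' : RtoC (Cmod p) <> RtoC 0) by (intros H; apply E; now apply RtoC_inj).
    exists (/ RtoC (Cmod p) * p)%C. split.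
    + rewrite Cmod_mult, Cmod_inv, Cmod_R, Rabs_pos_eq by (auto; apply Cmod_ge_0).
      now field.
    + now field.
Qed.

Lemma continuous_right (f : R -> R) (l eps : R) :
  continuous f 0 -> f 0 = l -> 0 < eps ->
  exists d, 0 < d /\ forall t, 0 < t <= d -> Rabs (f t - l) < eps.
Proof.
  intros Hf <- He.
  destruct (Hf _ (locally_ball (f 0) (mkposreal _ He))) as [d Hd].
  assert (H := cond_pos d). exists (d / 2). split; [lra|].
  intros t Ht. apply Hd. unfold ball; simpl; unfold AbsRing_ball, abs, minus, plus, opp; simpl.
  rewrite Rabs_pos_eq; lra.
Qed.

(* Speeding up the particle without changing the direction of [p], and moving
   [q] along its ray so as to keep the energy. *)
Lemma level_perturbation (s : R) (p q z : C) (eps : R) :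
  s <> 0 -> q <> RtoC 0 -> 0 < eps ->
  exists p' q' : C, p' <> RtoC 0 /\ q' <> RtoC 0 /\ q' <> z /\
    energy s p' q' = energy s p q /\ Cmod (p' - p)%C < eps /\ Cmod (q' - q)%C < eps.
Proof.
  intros Hs Hq He.
  assert (Hr := proj1 (Cmod_gt_0 q) Hq).
  destruct (unit_direction p) as (w & Hw & Hp).
  assert (HP := Cmod_ge_0 p).
  set (P := Cmod p) in *. set (r := Cmod q) in *.
  (* [N t] is the gain of kinetic energy when the speed goes from [P] to [P + t]. The factor [mu t]
     on [q] is the one for which [s / (mu t * r) = s / r + N t], so that the potential energy
     compensates. *)
  set (N := fun t => P * t + t ^ 2 / 2).
  set (mu := fun t => (s / r) / (s / r + N t)).
  assert (HK : s / r <> 0) by (apply Rmult_integral_contrapositive; split; [|apply Rinv_neq_0_compat]; lra).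
  assert (M0 : mu 0 = 1) by (unfold mu, N; field; lra).
  assert (Hc : continuous mu 0).
  { apply (ex_derive_continuous mu). unfold mu, N. auto_derive. simpl.
    intros H; apply HK. lra. }
  (* The bound [1 / 2] keeps [mu t] positive; the bound [eps / r] controls the displacement of
     [q]. *)
  assert (Hb : 0 < Rmin (1 / 2) (eps / r)).
  { apply Rmin_pos; [lra|]. now apply Rdiv_lt_0_compat. }
  destruct (continuous_right mu 1 _ Hc M0 Hb) as (d & Hd & Hmu).
  (* [N] is strictly increasing, so [t] and [t / 2] give different positions and at most one of them
     is the forbidden point [z]. *)
  assert (G : exists t, 0 < t <= d /\ t < eps /\ (RtoC (mu t) * q)%C <> z).
  { set (t := Rmin d (eps / 2)).
    assert (Ht : 0 < t) by (apply Rmin_pos; lra).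
    assert (Ht1 : t <= d) by apply Rmin_l.
    assert (Ht2 : t <= eps / 2) by apply Rmin_r.
    destruct (Ceq_dec (RtoC (mu t) * q)%C z) as [E|E].
    - exists (t / 2). repeat split; try lra. intros E'. rewrite <- E in E'.
      assert (D : (RtoC (mu (t / 2)%R - mu t) * q)%C = RtoC 0)
        by (rewrite RtoC_minus; transitivity (RtoC (mu (t / 2)%R) * q - RtoC (mu t) * q)%C;
          [ring|rewrite E'; ring]).
      apply (f_equal Cmod) in D. rewrite Cmod_mult, Cmod_0, Cmod_R in D. fold r in D.
      assert (D' : mu (t / 2) = mu t).
      { apply Rmult_integral in D as [D|D]; [|lra]. apply Rabs_eq_0 in D. lra. }
      unfold mu in D'. apply Rmult_eq_reg_l in D'; [|easy]. apply Rinv_eq_reg in D'.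
      unfold N in D'. nra.
    - exists t. repeat split; try lra. easy. }
  destruct G as (t & Ht & Hte & Hz).
  specialize (Hmu t Ht).
  assert (Hm1 := Rlt_le_trans _ _ _ Hmu (Rmin_l _ _)).
  assert (Hm2 := Rlt_le_trans _ _ _ Hmu (Rmin_r _ _)).
  apply Rabs_def2 in Hm1 as [_ Hm1].
  (* A vanishing denominator would give [mu t = 0] by the convention [/ 0 = 0], against
     [mu t > 1 / 2]. *)
  assert (HN : s / r + N t <> 0).
  { intros E. unfold mu in Hm1. rewrite E in Hm1. unfold Rdiv in Hm1. rewrite Rinv_0 in Hm1. lra. }
  exists (RtoC (P + t) * w)%C, (RtoC (mu t) * q)%C.
  repeat split; auto.
  - apply Cmod_gt_0. rewrite Cmod_scal; rewrite ?Hw; lra.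
  - apply Cmod_gt_0. rewrite Cmod_scal; [|lra]. apply Rmult_lt_0_compat; [lra|easy].
  - unfold energy. rewrite !Cmod_scal by lra. fold P r. rewrite Hw.
    replace (s / (mu t * r)) with (s / r + N t); [unfold N; field; lra|].
    unfold mu. field. repeat split; try lra; auto. intros E; apply HN.
    replace (s / r + N t) with ((s + N t * r) / r) by (field; lra). rewrite E; field; lra.
  - replace (RtoC (P + t) * w - p)%C with (RtoC t * w)%C
      by (rewrite Hp, RtoC_plus; ring).
    rewrite Cmod_scal; rewrite ?Hw; lra.
  - replace (RtoC (mu t) * q - q)%C with (RtoC (mu t - 1) * q)%C
      by (rewrite RtoC_minus; ring).
    rewrite Cmod_mult, Cmod_R. fold r.
    apply Rmult_lt_reg_r with (/ r); [now apply Rinv_0_lt_compat|].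
    replace (Rabs (mu t - 1) * r * / r) with (Rabs (mu t - 1)) by (field; lra). easy.
Qed.

Lemma rotation_perturbation (al : R) (w p q : C) (eps : R) :
  p <> RtoC 0 -> (q * (RtoC al * q + w))%C <> RtoC 0 -> 0 < eps ->
  exists p' : C, Cmod p' = Cmod p /\ Cmod (p' - p)%C < eps /\ minor al w q p' <> 0.
Proof.
  intros Hp Hk He. unfold minor. set (k := (q * _)%C) in *. clearbody k.
  destruct p as [a b], k as [x y]; simpl in *.
  destruct (Req_dec (x * (2 * a * b) - y * (a ^ 2 - b ^ 2)) 0) as [Z|Z].
  2:{ exists (a, b). simpl in *. repeat split; [|easy].
      replace (_ - _)%C with (RtoC 0) by ring. now rewrite Cmod_0. }
  (* [Q] is the real part of [conj(k) * p ^ 2], whose imaginary part is the minor. Both cannot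
     vanish, since the squared modulus is the product of the nonzero numbers in [F]. *)
  set (Q := x * (a ^ 2 - b ^ 2) + y * (2 * a * b)).
  assert (HQ : Q <> 0).
  { intros E. apply norm2_pos in Hp, Hk. simpl in Hp, Hk.
    assert (F : (x ^ 2 + y ^ 2) * (a ^ 2 + b ^ 2) ^ 2 =
      (x * (2 * a * b) - y * (a ^ 2 - b ^ 2)) ^ 2 + Q ^ 2) by (unfold Q; ring).
    rewrite Z, E in F.
    assert (0 < (x ^ 2 + y ^ 2) * (a ^ 2 + b ^ 2) ^ 2).
    { apply Rmult_lt_0_compat; [easy|]. now apply pow_lt. }
    simpl in *; lra. }
  set (m := Cmod (a, b)).
  set (g := fun t => Cmod ((cos t, sin t) - RtoC 1)%C * m).
  assert (Hg : continuous g 0).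
  { apply cont_mult; [|apply continuous_const].
    apply cont_Cmod; simpl; apply (ex_derive_continuous (V := R_NormedModule)); auto_derive; easy. }
  assert (G0 : g 0 = 0).
  { unfold g. rewrite cos_0, sin_0. replace (_ - _)%C with (RtoC 0) by (apply injective_projections; simpl; ring).
    rewrite Cmod_0. ring. }
  destruct (continuous_right g 0 eps Hg G0 He) as (d & Hd & Hgd).
  (* Rotating [p] by [t] turns [p ^ 2] by [2 * t], so the minor becomes [Q * sin (2 * t)]; the bound
     [PI / 4] keeps the sine positive. *)
  set (t := Rmin d (PI / 4)).
  assert (HPI := PI_RGT_0).
  assert (Ht : 0 < t) by (apply Rmin_pos; lra).
  assert (Ht1 : t <= d) by apply Rmin_l.
  assert (Ht2 : t <= PI / 4) by apply Rmin_r.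
  exists ((cos t, sin t) * (a, b))%C. split; [|split].
  - rewrite Cmod_mult. unfold Cmod at 1; simpl.
    replace (_ + _) with (Rsqr (sin t) + Rsqr (cos t)) by (unfold Rsqr; ring).
    rewrite sin2_cos2, sqrt_1. apply Rmult_1_l.
  - replace (_ - _)%C with (((cos t, sin t) - RtoC 1) * (a, b))%C by (apply injective_projections; simpl; ring).
    rewrite Cmod_mult. fold m. eapply Rle_lt_trans; [|apply (Hgd t); lra].
    rewrite Rminus_0_r. apply Rle_abs.
  - simpl.
    match goal with |- ?l <> 0 => replace l with (Q * sin (2 * t) +
      (x * (2 * a * b) - y * (a ^ 2 - b ^ 2)) * cos (2 * t)) end.
    + rewrite Z. assert (0 < sin (2 * t)) by (apply sin_gt_0; lra).
      assert (Q * sin (2 * t) <> 0) by (apply Rmult_integral_contrapositive; split; lra). lra.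
    + rewrite sin_2a, cos_2a. unfold Q. ring.
Qed.

Lemma fint_independent (s e0 al : R) (w : C) :
  s <> 0 -> al <> 0 \/ w <> RtoC 0 -> independent_on_level s e0 (fint s al w).
Proof.
  intros Hs Hw p q Hq He eps Heps.
  (* The point to avoid is the zero of [al * q + w]; when [al = 0] this factor is the constant [w],
     nonzero by hypothesis. Half of [eps] is kept for the rotation of the momentum. *)
  destruct (level_perturbation s p q (- w / RtoC al)%C (eps / 2))
    as (p1 & q1 & Hp1 & Hq1 & Hz & He1 & Hpd & Hqd); [easy|easy|lra|].
  assert (Hk : (q1 * (RtoC al * q1 + w))%C <> RtoC 0).
  { apply Cmult_neq_0; [easy|]. intros E.
    destruct (Req_dec al 0) as [->|Ha].
    - destruct Hw as [Hw|Hw]; [easy|]. apply Hw. rewrite <- E. ring.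
    - apply Hz. assert (RtoC al <> RtoC 0) by (intros H; apply Ha; now apply RtoC_inj).
      replace (- w)%C with (RtoC al * q1)%C; [now field|].
      transitivity (RtoC al * q1 + w - w)%C; [ring|rewrite E; ring]. }
  destruct (rotation_perturbation al w p1 q1 (eps / 2) Hp1 Hk) as (p2 & Hm & Hp2 & Hn); [lra|].
  exists p2, q1. split; [easy|]. split; [|split; [|split]].
  - rewrite <- He, <- He1. unfold energy. now rewrite Hm.
  - replace (p2 - p)%C with ((p2 - p1) + (p1 - p))%C by ring.
    eapply Rle_lt_trans; [apply Cmod_triangle|lra].
  - lra.
  - now apply independent_of_minor.
Qed.

(** * Reflection at focused conics *)

(* For [v] tangent to a wall at [q], this makes the quadratic part of
   [fint s al w] in [p] invariant under the reflection fixing [v]. *)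
Definition reflective (al : R) (w q v : C) : Prop :=
  2 * al * cross q v * dot q v + cross w v * dot q v + cross q v * dot w v = 0.

(** In the orthogonal frame [v], [Ci * v] the reflection changes the sign of the second component
    [Y] of [p] only. Of the quadratic part, just the [X * Y] term is affected, and its coefficient
    is the expression in [reflective], up to the factor [n ^ 2]. *)
Lemma fint_reflection (s al : R) (w p p' q v : C) :
  v <> RtoC 0 -> dot p' v = dot p v -> dot p' (Ci * v)%C = - dot p (Ci * v)%C ->
  reflective al w q v -> fint s al w p' q = fint s al w p q.
Proof.
  intros Hv%norm2_pos H1 H2 HN.
  assert (E : forall x y : C, cross x y = (dot y v * cross x v + dot y (Ci * v)%C * dot x v) / (fst v ^ 2 + snd v ^ 2)).
  { intros [x1 x2] [y1 y2]. destruct v as [v1 v2]. unfold cross, dot, Ci in *; simpl in *. field. lra. }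
  unfold fint. rewrite !(E _ p'), !(E _ p), H1, H2. f_equal. unfold reflective in HN.
  set (X := dot p v) in *. set (Y := dot p (_ * _)%C) in *. set (n := _ + snd v ^ 2) in *.
  apply Rminus_diag_uniq.
  transitivity (- 2 * X * Y * (2 * al * cross q v * dot q v + cross w v * dot q v + cross q v * dot w v) / n ^ 2).
  - field. lra.
  - rewrite HN. field. lra.
Qed.

Definition reflective_wall (B : C -> Prop) (al : R) (w : C) : Prop :=
  forall q v : C, q <> RtoC 0 -> tangent B q v -> reflective al w q v.

Lemma fint_first_integral (s e0 al : R) (w : C) (B : C -> Prop) :
  s <> 0 -> al <> 0 \/ w <> RtoC 0 -> reflective_wall B al w ->
  additional_first_integral s e0 B (fint s al w).
Proof.
  intros Hs Hw HB. split; [|split; [|split]].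
  - apply fint_C1.
  - now apply fint_independent.
  - intros t0 t1 p q H _. now apply (fint_motion s al w t0 t1).
  - intros p q p' Hq _ [_ (v & Ht & H1 & H2)].
    apply fint_reflection with v; auto. apply Ht.
Qed.

(** * Tangents to quadrics and the reflection property of conics *)

Lemma tangent_mono (B B' : C -> Prop) (q v : C) :
  (forall z, B z -> B' z) -> tangent B q v -> tangent B' q v.
Proof.
  intros H (Hv & c & H0 & Hc & H1 & H2). split; [easy|]. exists c. split; [easy|]. split; [|easy].
  apply filter_imp with (2 := Hc). auto.
Qed.

Lemma tangent_on (B : C -> Prop) (q v : C) : tangent B q v -> B q.
Proof.
  intros (_ & c & <- & Hc & _). exact (locally_singleton _ _ Hc).
Qed.

(** The chain rule along the curve. All walls are handled by enclosing them in a polynomial curve of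
    degree at most two and using this relation. *)
Lemma tangent_quadric (b0 b1 b2 a11 a12 a22 : R) (q v : C) :
  tangent (fun z => b0 + b1 * fst z + b2 * snd z
    + a11 * fst z ^ 2 + a12 * (fst z * snd z) + a22 * snd z ^ 2 = 0) q v ->
  b1 * fst v + b2 * snd v + 2 * a11 * fst q * fst v + a12 * (fst v * snd q + fst q * snd v)
    + 2 * a22 * snd q * snd v = 0.
Proof.
  intros (_ & c & H0 & Hc & H1 & H2).
  set (x := fun t => fst (c t)) in *. set (y := fun t => snd (c t)) in *.
  assert (Hx : x 0 = fst q) by (unfold x; now rewrite H0).
  assert (Hy : y 0 = snd q) by (unfold y; now rewrite H0).
  rewrite <- Hx, <- Hy. symmetry.
  transitivity (Derive (fun _ => 0) 0); [symmetry; apply Derive_const|].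
  transitivity (Derive (fun t => b0 + b1 * x t + b2 * y t + a11 * x t ^ 2 + a12 * (x t * y t) + a22 * y t ^ 2) 0).
  - apply Derive_ext_loc. apply filter_imp with (2 := Hc). intros t Ht. symmetry. exact Ht.
  - apply is_derive_unique. auto_derive.
    + repeat split; eexists; eassumption.
    + replace (Derive (fun t => x t) 0) with (fst v) by (symmetry; now apply is_derive_unique).
      replace (Derive (fun t => y t) 0) with (snd v) by (symmetry; now apply is_derive_unique).
      ring.
Qed.

(** The focus-directrix equation [ka * Cmod q = g + dot h q], squared so as to be polynomial and to
    contain both branches; [ka = 0] gives a line counted twice. *)
Definition conic (ka g : R) (h q : C) : Prop := (g + dot h q) ^ 2 = ka ^ 2 * Cmod q ^ 2.

(** For a nondegenerate conic with [al <> 0], the point [- w / al] is the second focus; for a line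
    ([ka = 0]) it is the mirror image of the origin. Parabolas have [al = 0]. *)
Lemma conic_reflective_wall (ka g : R) (h : C) :
  reflective_wall (conic ka g h) (ka ^ 2 - Cmod h ^ 2) (RtoC (- 2 * g) * h)%C.
Proof.
  intros q v Hq%norm2_pos Ht.
  assert (Hon := tangent_on _ _ _ Ht). unfold conic in Hon. rewrite Cmod_sq in Hon.
  rewrite Cmod_sq.
  (* For [ka = 0] the squared equation has zero differential on the curve, so the linear equation is
     differentiated instead. *)
  destruct (Req_dec ka 0) as [->|Hk].
  - assert (D : dot h v = 0).
    { apply (tangent_mono _ (fun z => g + fst h * fst z + snd h * snd z + 0 * fst z ^ 2
        + 0 * (fst z * snd z) + 0 * snd z ^ 2 = 0)),
        tangent_quadric in Ht.
      - unfold dot. rewrite <- Ht. ring.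
      - intros z Hz. unfold conic, dot in Hz. nra. }
    assert (E : g + dot h q = 0) by nra.
    clear Hon Ht Hq. destruct h as [h1 h2], q as [q1 q2], v as [v1 v2].
    unfold reflective, dot, cross, RtoC in *; simpl in *.
    assert (g = - (h1 * q1 + h2 * q2)) as -> by lra.
    transitivity (- 2 * (h1 * v1 + h2 * v2) * ((q1 * v1 + q2 * v2) * (q1 * h2 - q2 * h1)
      - (h1 * q1 + h2 * q2) * (q1 * v2 - q2 * v1))); [ring|rewrite D; ring].
  - apply (tangent_mono _ (fun z => g ^ 2 + (2 * g * fst h) * fst z + (2 * g * snd h) * snd z
       + (fst h ^ 2 - ka ^ 2) * fst z ^ 2 + (2 * fst h * snd h) * (fst z * snd z)
       + (snd h ^ 2 - ka ^ 2) * snd z ^ 2 = 0)),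
        tangent_quadric in Ht.
    2:{ intros z Hz. unfold conic, dot in Hz. rewrite Cmod_sq in Hz. nra. }
    assert (D : ka ^ 2 * dot q v = (g + dot h q) * dot h v) by (unfold dot; lra).
    (* Up to the factor [ka ^ 2], the expression is a combination of the tangency equation [D] and
       the equation [Hon] of the curve. *)
    apply Rmult_eq_reg_l with (ka ^ 2); [|now apply pow_nonzero].
    transitivity (2 * (ka ^ 2 * dot q v - (g + dot h q) * dot h v)
        * (ka ^ 2 * cross q v - (g + dot h q) * cross h v)
      + 2 * dot h v * cross h v * (ka ^ 2 * (fst q ^ 2 + snd q ^ 2) - (g + dot h q) ^ 2)).
    + clear. destruct h as [h1 h2], q as [q1 q2], v as [v1 v2].
      unfold dot, cross, RtoC; simpl. ring.
    + rewrite D, Hon. ring.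
Qed.

Lemma reflective_wall_sub (B B' : C -> Prop) (al : R) (w : C) :
  (forall q, B q -> B' q) -> reflective_wall B' al w -> reflective_wall B al w.
Proof. intros H HB q v Hq Ht. apply HB; [easy|]. now apply tangent_mono with B. Qed.

(** [reflective] is linear in [(al, w)], so the pair given by [conic_reflective_wall] may be divided
    by a common factor [l]; this yields the normalizations [al = 1] and, for parabolas, [w = u]. *)
Lemma axial_conic_reflective_wall (B : C -> Prop) (ka g c al t l : R) (u : C) :
  Cmod u = 1 -> l <> 0 -> ka ^ 2 - c ^ 2 = l * al -> - 2 * g * c = l * t ->
  (forall q, B q -> (g + c * dot u q) ^ 2 = ka ^ 2 * Cmod q ^ 2) ->
  reflective_wall B al (RtoC t * u)%C.
Proof.
  intros Hu Hl Hal Ht HB q v Hq HT.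
  assert (H := conic_reflective_wall ka g (RtoC c * u)%C q v Hq).
  rewrite Cmod_mult, Hu, Cmod_R, Rmult_1_r, pow2_abs, Hal in H.
  apply Rmult_eq_reg_l with l; [|easy]. rewrite Rmult_0_r.
  etransitivity; [|apply H; clear H].
  - replace (RtoC (-2 * g) * (RtoC c * u))%C with (RtoC l * (RtoC t * u))%C.
    + unfold cross, dot, RtoC; simpl. ring.
    + rewrite !Cmult_assoc, <- !RtoC_mult, Ht. easy.
  - apply tangent_mono with (2 := HT). intros z Hz. unfold conic. rewrite <- HB by easy.
    f_equal. unfold dot, RtoC; simpl. ring.
Qed.

(** Here [q], [v] and [h] are parallel, so each term of [reflective] contains a vanishing cross
    product. This serves the degenerate conics, for which the factor [l] would be zero. *)
Lemma collinear_reflective_wall (al t : R) (h : C) :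
  h <> RtoC 0 -> reflective_wall (fun z => cross h z = 0) al (RtoC t * h)%C.
Proof.
  intros Hh%norm2_pos q v _ Ht.
  assert (Hq := tangent_on _ _ _ Ht). simpl in Hq.
  assert (Hv : cross h v = 0).
  { apply (tangent_mono _ (fun z => 0 + (- snd h) * fst z + fst h * snd z + 0 * fst z ^ 2
      + 0 * (fst z * snd z) + 0 * snd z ^ 2 = 0)), tangent_quadric in Ht.
    - unfold cross. lra.
    - intros z Hz. unfold cross in Hz. lra. }
  assert (E : cross q v = 0).
  { apply Rmult_eq_reg_l with (fst h ^ 2 + snd h ^ 2); [|lra].
    transitivity (dot h q * cross h v - dot h v * cross h q); [unfold dot, cross; ring|].
    rewrite Hv, Hq. ring. }
  unfold reflective. rewrite E.
  replace (cross (RtoC t * h)%C v) with (t * cross h v) by (unfold cross, RtoC; simpl; ring).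
  rewrite Hv. ring.
Qed.

(** The equality case of the Cauchy-Schwarz inequality. *)
Lemma cross_0_of_dot (x y : C) :
  dot x y ^ 2 = Cmod x ^ 2 * Cmod y ^ 2 -> cross x y = 0.
Proof.
  rewrite !Cmod_sq. intros H.
  assert (E : cross x y * cross x y = 0) by (unfold cross, dot in *; nra).
  destruct (Rmult_integral _ _ E); easy.
Qed.

Lemma parabola_reflective_wall (u : C) (d : R) :
  Cmod u = 1 -> reflective_wall (parabola u d) 0 u.
Proof.
  intros Hu.
  assert (HB : forall q, parabola u d q -> (- d + 1 * dot u q) ^ 2 = 1 ^ 2 * Cmod q ^ 2).
  { intros q ->. rewrite pow2_abs. ring. }
  replace u with (RtoC 1 * u)%C by ring.
  destruct (Req_dec d 0) as [->|Hd].
  - apply reflective_wall_sub with (fun z => cross u z = 0).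
    + intros q Hq. apply cross_0_of_dot. rewrite Hu, <- HB; [ring|].
      now rewrite Cmult_1_l in Hq.
    + apply collinear_reflective_wall. apply Cmod_gt_0. lra.
  - apply (axial_conic_reflective_wall _ 1 (- d) 1 _ _ (2 * d)); try easy; try lra.
    rewrite Cmult_1_l. exact HB.
Qed.

Lemma two_foci_reflective_wall (B : C -> Prop) (F k : R) (u : C) :
  Cmod u = 1 -> F <> 0 \/ k <> 0 ->
  (forall q, B q -> (4 * k ^ 2 - F ^ 2 + 2 * F * dot u q) ^ 2 = (4 * k) ^ 2 * Cmod q ^ 2) ->
  reflective_wall B 1 (RtoC (- F) * u)%C.
Proof.
  intros Hu HF HB.
  (* When [4 * k ^ 2 = F ^ 2] the equation reduces to [dot u q ^ 2 = Cmod q ^ 2], the focal axis,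
     which contains the degenerate segment and rays. *)
  destruct (Req_dec (4 * k ^ 2 - F ^ 2) 0) as [E|E].
  - apply reflective_wall_sub with (fun z => cross u z = 0).
    + intros q Hq. apply cross_0_of_dot. rewrite Hu.
      assert (F <> 0) by (destruct HF; [easy|]; nra).
      apply HB in Hq. rewrite E in Hq.
      apply Rmult_eq_reg_l with (F ^ 2); [|now apply pow_nonzero]. nra.
    + apply collinear_reflective_wall. apply Cmod_gt_0. lra.
  - apply (axial_conic_reflective_wall _ (4 * k) (4 * k ^ 2 - F ^ 2) (2 * F) _ _ (4 * (4 * k ^ 2 - F ^ 2)));
      try easy; try lra.
Qed.

Lemma line_reflective_wall (u : C) (d : R) :
  Cmod u = 1 -> reflective_wall (line u d) 1 (RtoC (- (2 * d)) * u)%C.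
Proof.
  intros Hu. apply (axial_conic_reflective_wall _ 0 (- d) 1 _ _ (- 1)); try easy; try lra.
  unfold line. intros q ->. ring.
Qed.

(** Away from the origin a tangent vector is parallel to the line through [q], hence to [q] itself,
    and with [w = 0] the factor [cross q v] is left in [reflective]. *)
Lemma line_pair_reflective_wall (u w : C) :
  Cmod u = 1 -> Cmod w = 1 ->
  reflective_wall (fun q => line u 0 q \/ line w 0 q) 1 (RtoC 0).
Proof.
  unfold line.
  enough (W : forall u w q v, Cmod u = 1 -> Cmod w = 1 -> q <> RtoC 0 ->
    tangent (fun q => dot u q = 0 \/ dot w q = 0) q v -> dot u q = 0 -> reflective 1 (RtoC 0) q v).
  { intros Hu Hw q v Hq Ht. destruct (tangent_on _ _ _ Ht) as [H|H].
    - now apply (W u w).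
    - apply (W w u); auto. apply tangent_mono with (2 := Ht). tauto. }
  clear. intros u w q v Hu Hw Hq Ht H.
  assert (Hu1 := Cmod_sq u). assert (Hw1 := Cmod_sq w). rewrite Hu in Hu1. rewrite Hw in Hw1.
  assert (Hu0 : u <> RtoC 0) by (apply Cmod_gt_0; lra).
  assert (D : dot u v = 0).
  (* If [q] lies on both lines they coincide. Otherwise the product [dot u z * dot w z], which
     vanishes on the pair, is differentiated at [q], and only [dot w q * dot u v] survives. *)
  { destruct (Req_dec (dot w q) 0) as [Z|Z].
    - assert (E : cross u w = 0).
      { apply norm2_pos in Hq.
        apply Rmult_eq_reg_l with (fst q ^ 2 + snd q ^ 2); [|lra].
        transitivity (dot u q * cross q w - dot w q * cross q u); [unfold dot, cross; ring|].
        rewrite H, Z. ring. }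
      apply (tangent_mono _ (fun z => 0 + fst u * fst z + snd u * snd z + 0 * fst z ^ 2
        + 0 * (fst z * snd z) + 0 * snd z ^ 2 = 0)), tangent_quadric in Ht.
      + unfold dot. lra.
      + intros z Hz. enough (dot u z = 0) by (unfold dot in *; lra).
        destruct Hz as [Hz|Hz]; [easy|].
        transitivity (dot u z * (fst w ^ 2 + snd w ^ 2)); [rewrite <- Hw1; ring|].
        transitivity (dot u w * dot w z + cross u w * cross z w); [unfold dot, cross; ring|].
        rewrite E, Hz. ring.
    - apply (tangent_mono _ (fun z => 0 + 0 * fst z + 0 * snd z + (fst u * fst w) * fst z ^ 2
        + (fst u * snd w + snd u * fst w) * (fst z * snd z) + (snd u * snd w) * snd z ^ 2 = 0)),
          tangent_quadric in Ht.
      + apply Rmult_eq_reg_l with (dot w q); [|easy].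
        transitivity (dot w q * dot u v + dot u q * dot w v); [rewrite H; ring|].
        rewrite Rmult_0_r, <- Ht. unfold dot. ring.
      + intros z Hz. transitivity (dot u z * dot w z); [unfold dot; ring|].
        destruct Hz as [-> | ->]; ring. }
  assert (E : cross q v = 0).
  { transitivity ((fst u ^ 2 + snd u ^ 2) * cross q v); [rewrite <- Hu1; ring|].
    transitivity (dot u q * cross u v - dot u v * cross u q); [unfold dot, cross; ring|].
    rewrite H, D. ring. }
  unfold reflective. rewrite E. unfold cross, RtoC; simpl. ring.
Qed.

(** * The explicit integrals as members of the family [fint] *)

Lemma rotated_coordinates (u p q : C) :
  Cmod u = 1 ->
  cross (Cconj u * q)%C (Cconj u * p)%C = cross q p /\ Cmod (Cconj u * q)%C = Cmod q.
Proof.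
  intros Hu. split.
  - assert (E := Cmod_sq u). rewrite Hu in E.
    transitivity ((fst u ^ 2 + snd u ^ 2) * cross q p); [|rewrite <- E; ring].
    unfold cross, Cconj; simpl; ring.
  - rewrite Cmod_mult, Cmod_conj, Hu. ring.
Qed.

Lemma rotated_laplace (s : R) (u : C) :
  Cmod u = 1 -> rotated u (laplace s) = fint s 0 u.
Proof.
  intros Hu. apply functional_extensionality; intros p. apply functional_extensionality; intros q.
  destruct (rotated_coordinates u p q Hu) as [E1 E2].
  unfold rotated, laplace, fint. rewrite <- E1, <- E2. unfold Cmod.
  set (P := (Cconj u * p)%C) in *. set (Q := (Cconj u * q)%C) in *.
  assert (F1 : cross u p = snd P) by (unfold P, cross, Cconj; simpl; ring).
  assert (F2 : dot u q = fst Q) by (unfold Q, dot, Cconj; simpl; ring).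
  rewrite F1, F2. unfold cross. f_equal. ring.
Qed.

Lemma rotated_A (s ta : R) (u : C) :
  Cmod u = 1 -> rotated u (A s ta) = fint s 1 (RtoC (- (2 * ta)) * u)%C.
Proof.
  intros Hu. apply functional_extensionality; intros p. apply functional_extensionality; intros q.
  assert (E := f_equal (fun F => F p q) (rotated_laplace s u Hu)).
  destruct (rotated_coordinates u p q Hu) as [E1 _].
  unfold rotated, A in *. rewrite E.
  unfold fint. rewrite <- E1.
  unfold cross at 1 2 3 4 5, dot, Rdiv, RtoC. simpl. unfold cross; simpl. ring.
Qed.

(** * The complex square mapping *)

(** The half-angle formulas give the absolute values of the coordinates of a root; the sign of the
    imaginary part has to follow that of [y]. *)
Lemma complex_sqrt (q : C) : exists z : C, (z * z)%C = q.
Proof.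
  destruct q as [x y].
  assert (H := Cmod_sq (x, y)). assert (H0 := Cmod_ge_0 (x, y)).
  set (r := Cmod (x, y)) in *. simpl fst in H; simpl snd in H.
  assert (Hx : - r <= x <= r) by (split; nra).
  set (c := sqrt ((r + x) / 2)). set (d := sqrt ((r - x) / 2)).
  assert (Hc : c * c = (r + x) / 2) by (apply sqrt_sqrt; lra).
  assert (Hd : d * d = (r - x) / 2) by (apply sqrt_sqrt; lra).
  assert (Hcd : c * d = Rabs y / 2).
  { unfold c, d. rewrite <- sqrt_mult_alt by lra.
    replace ((r + x) / 2 * ((r - x) / 2)) with (Rsqr (y / 2)) by (unfold Rsqr; nra).
    rewrite sqrt_Rsqr_abs. unfold Rdiv. rewrite Rabs_mult, (Rabs_pos_eq (/ 2)); lra. }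
  destruct (Rle_dec 0 y) as [L|L].
  - rewrite Rabs_pos_eq in Hcd by easy.
    exists (c, d). apply injective_projections; simpl; lra.
  - rewrite Rabs_left in Hcd by lra.
    exists (c, - d). apply injective_projections; simpl; lra.
Qed.

Lemma unit_sqrt (u : C) : Cmod u = 1 -> exists v : C, Cmod v = 1 /\ (v * v)%C = u.
Proof.
  intros Hu. destruct (complex_sqrt u) as (v & <-). exists v. split; [|easy].
  rewrite Cmod_mult in Hu. assert (H := Cmod_ge_0 v). nra.
Qed.

Lemma unit_square (v : C) : Cmod v = 1 -> Cmod (v * v)%C = 1.
Proof. intros Hv. rewrite Cmod_mult, Hv. ring. Qed.

(* Half-angle formulas: the squared coordinates of [z] in the frame of [v] are
   affine functions of [Cmod q] and of the coordinate of [q = z * z] along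
   [v * v]. *)
Lemma square_image_iff (Z : C -> Prop) (P : R -> R -> Prop) (v q : C) :
  Cmod v = 1 ->
  (forall z, Z z <-> P (fst (Cconj v * z)%C ^ 2) (snd (Cconj v * z)%C ^ 2)) ->
  square_image Z q <->
  P ((Cmod q + dot (v * v)%C q) / 2) ((Cmod q - dot (v * v)%C q) / 2).
Proof.
  intros Hv HZ.
  assert (E : forall z, fst (Cconj v * z)%C ^ 2 = (Cmod (z * z)%C + dot (v * v)%C (z * z)%C) / 2 /\
    snd (Cconj v * z)%C ^ 2 = (Cmod (z * z)%C - dot (v * v)%C (z * z)%C) / 2).
  { intros z.
    assert (M : Cmod (z * z)%C = fst (Cconj v * z)%C ^ 2 + snd (Cconj v * z)%C ^ 2).
    { rewrite <- Cmod_sq, !Cmod_mult, Cmod_conj, Hv. ring. }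
    assert (D : dot (v * v)%C (z * z)%C = fst (Cconj v * z)%C ^ 2 - snd (Cconj v * z)%C ^ 2).
    { unfold dot, Cconj; simpl. ring. }
    rewrite M, D. lra. }
  split.
  - intros (z & Hz & ->). apply HZ in Hz. now rewrite !(proj1 (E z)), !(proj2 (E z)) in Hz.
  (* Membership in [Z] depends on squared coordinates only, so either root of [q] will do. *)
  - intros H. destruct (complex_sqrt q) as (z & <-). exists z. split; [|easy].
    apply HZ. now rewrite (proj1 (E z)), (proj2 (E z)).
Qed.

Lemma square_image_ellipse (a b : R) (v q : C) :
  Cmod v = 1 -> a <> 0 -> b <> 0 ->
  square_image (centered_ellipse a b v) q <->
  (a ^ 2 + b ^ 2) * Cmod q - (a ^ 2 - b ^ 2) * dot (v * v)%C q = 2 * a ^ 2 * b ^ 2.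
Proof.
  intros Hv Ha Hb.
  rewrite (square_image_iff _ (fun X Y => X / a ^ 2 + Y / b ^ 2 = 1) v) by easy.
  set (r := Cmod q). set (x := dot _ q).
  replace ((r + x) / 2 / a ^ 2 + (r - x) / 2 / b ^ 2) with
    (((a ^ 2 + b ^ 2) * r - (a ^ 2 - b ^ 2) * x) / (2 * a ^ 2 * b ^ 2)) by (field; auto).
  assert (Hn : 2 * a ^ 2 * b ^ 2 <> 0) by (repeat apply Rmult_integral_contrapositive_currified; auto; lra).
  split; intros H.
  - apply Rmult_eq_reg_r with (/ (2 * a ^ 2 * b ^ 2)); [|now apply Rinv_neq_0_compat].
    rewrite Rinv_r by easy. exact H.
  - rewrite H. now apply Rinv_r.
Qed.

(** Exchanging [a] and [b] only changes the sign in front of [Cmod q], which is the passage to the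
    other branch. *)
Lemma square_image_hyperbola (a b : R) (v q : C) :
  Cmod v = 1 -> a <> 0 -> b <> 0 ->
  square_image (centered_hyperbola a b v) q <->
  (a ^ 2 + b ^ 2) * dot (v * v)%C q - (a ^ 2 - b ^ 2) * Cmod q = 2 * a ^ 2 * b ^ 2.
Proof.
  intros Hv Ha Hb.
  rewrite (square_image_iff _ (fun X Y => X / a ^ 2 - Y / b ^ 2 = 1) v) by easy.
  set (r := Cmod q). set (x := dot _ q).
  replace ((r + x) / 2 / a ^ 2 - (r - x) / 2 / b ^ 2) with
    (((a ^ 2 + b ^ 2) * x - (a ^ 2 - b ^ 2) * r) / (2 * a ^ 2 * b ^ 2)) by (field; auto).
  assert (Hn : 2 * a ^ 2 * b ^ 2 <> 0) by (repeat apply Rmult_integral_contrapositive_currified; auto; lra).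
  split; intros H.
  - apply Rmult_eq_reg_r with (/ (2 * a ^ 2 * b ^ 2)); [|now apply Rinv_neq_0_compat].
    rewrite Rinv_r by easy. exact H.
  - rewrite H. now apply Rinv_r.
Qed.

Lemma square_image_asymptotes (a b : R) (v q : C) :
  Cmod v = 1 -> a <> 0 -> b <> 0 ->
  square_image (centered_asymptotes a b v) q <->
  (a ^ 2 + b ^ 2) * dot (v * v)%C q - (a ^ 2 - b ^ 2) * Cmod q = 0.
Proof.
  intros Hv Ha Hb.
  rewrite (square_image_iff _ (fun X Y => X / a ^ 2 - Y / b ^ 2 = 0) v) by easy.
  set (r := Cmod q). set (x := dot _ q).
  replace ((r + x) / 2 / a ^ 2 - (r - x) / 2 / b ^ 2) with
    (((a ^ 2 + b ^ 2) * x - (a ^ 2 - b ^ 2) * r) / (2 * a ^ 2 * b ^ 2)) by (field; auto).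
  assert (Hn : 2 * a ^ 2 * b ^ 2 <> 0) by (repeat apply Rmult_integral_contrapositive_currified; auto; lra).
  split; intros H.
  - apply Rmult_integral in H as [H|H]; [easy|]. now apply Rinv_neq_0_compat in H.
  - rewrite H. unfold Rdiv. ring.
Qed.

Lemma ellipse_ecc_sq (a b : R) : 0 < b <= a -> a ^ 2 * ellipse_ecc a b ^ 2 = a ^ 2 - b ^ 2.
Proof.
  intros H. unfold ellipse_ecc.
  assert (E : 1 - b ^ 2 / a ^ 2 = (a ^ 2 - b ^ 2) / a ^ 2) by (field; lra).
  rewrite E, pow2_sqrt; [field; lra|].
  apply Rdiv_le_0_compat; nra.
Qed.

Lemma hyperbola_ecc_sq (a b : R) : 0 < a -> a ^ 2 * hyperbola_ecc a b ^ 2 = a ^ 2 + b ^ 2.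
Proof.
  intros H. unfold hyperbola_ecc.
  assert (E : 1 + b ^ 2 / a ^ 2 = (a ^ 2 + b ^ 2) / a ^ 2) by (field; lra).
  rewrite E, pow2_sqrt; [field; lra|].
  apply Rdiv_le_0_compat; nra.
Qed.

Lemma corresponds_unit (B : C -> Prop) (ta : R) (u : C) : corresponds B ta u -> Cmod u = 1.
Proof. intros []; now apply unit_square. Qed.

(** The images are conics with [ka] and [c] equal, up to sign and order, to [a ^ 2 + b ^ 2] and
    [a ^ 2 - b ^ 2]. The difference of their squares gives the factor [l], equal to
    [4 * a ^ 2 * b ^ 2] up to sign, and the second focus is [2 * ta * u]. *)
Lemma corresponds_reflective_wall (B : C -> Prop) (ta : R) (u : C) :
  corresponds B ta u -> reflective_wall B 1 (RtoC (- (2 * ta)) * u)%C.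
Proof.
  intros [a b v Hab Hv HB | a b v Ha Hb Hv HB | a b v Ha Hb Hv HB | a b v Ha Hb Hv HB];
    try rewrite ellipse_ecc_sq by easy; try rewrite hyperbola_ecc_sq by easy;
    assert (Hu := unit_square v Hv).
  - apply (axial_conic_reflective_wall _ (a ^ 2 + b ^ 2) (2 * a ^ 2 * b ^ 2) (a ^ 2 - b ^ 2) _ _
      (4 * a ^ 2 * b ^ 2) _ Hu); [|ring|field|].
    { repeat apply Rmult_integral_contrapositive_currified; nra. }
    intros q Hq. apply HB, square_image_ellipse in Hq; [|easy|lra|lra].
    rewrite <- Hq. ring.
  - apply (axial_conic_reflective_wall _ (a ^ 2 - b ^ 2) (2 * a ^ 2 * b ^ 2) (- (a ^ 2 + b ^ 2)) _ _
      (- 4 * a ^ 2 * b ^ 2) _ Hu); [|ring|field|].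
    { repeat apply Rmult_integral_contrapositive_currified; nra. }
    intros q Hq. apply HB, square_image_hyperbola in Hq; [|easy|lra|lra].
    rewrite <- Hq. ring.
  - apply (axial_conic_reflective_wall _ (a ^ 2 - b ^ 2) (2 * a ^ 2 * b ^ 2) (- (a ^ 2 + b ^ 2)) _ _
      (- 4 * a ^ 2 * b ^ 2) _ Hu); [|ring|field|].
    { repeat apply Rmult_integral_contrapositive_currified; nra. }
    intros q Hq. apply HB in Hq as [Hq|Hq]; apply square_image_hyperbola in Hq; try easy; try lra.
    + rewrite <- Hq. ring.
    + replace (2 * a ^ 2 * b ^ 2) with (2 * b ^ 2 * a ^ 2) by ring. rewrite <- Hq. ring.
  - apply (axial_conic_reflective_wall _ (a ^ 2 - b ^ 2) 0 (- (a ^ 2 + b ^ 2)) _ _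
      (- 4 * a ^ 2 * b ^ 2) _ Hu); [|ring|field|].
    { repeat apply Rmult_integral_contrapositive_currified; nra. }
    intros q Hq. apply HB, square_image_asymptotes in Hq; [|easy|lra|lra].
    assert (E : (a ^ 2 + b ^ 2) * dot (v * v)%C q = (a ^ 2 - b ^ 2) * Cmod q) by lra.
    transitivity (((a ^ 2 + b ^ 2) * dot (v * v)%C q) ^ 2); [ring|rewrite E; ring].
Qed.

(** * From the two-focus equations to equations affine in [Cmod q] *)

Lemma Cmod_sq_minus_axis (F : R) (u q : C) :
  Cmod u = 1 -> Cmod (q - RtoC F * u)%C ^ 2 = Cmod q ^ 2 - 2 * F * dot u q + F ^ 2.
Proof.
  intros Hu. assert (E := Cmod_sq u). rewrite Hu in E. rewrite !Cmod_sq.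
  transitivity (fst q ^ 2 + snd q ^ 2 - 2 * F * dot u q + F ^ 2 * (fst u ^ 2 + snd u ^ 2)).
  - unfold dot, RtoC; simpl. ring.
  - rewrite <- E. ring.
Qed.

(** The triangle inequality for the two foci and [q]; it discards the wrong signs introduced by
    squaring the two-focus equations. *)
Lemma Cmod_minus_axis_ge (F : R) (u q : C) :
  Cmod u = 1 -> 0 <= F ->
  Rabs (F - Cmod q) <= Cmod (q - RtoC F * u)%C.
Proof.
  intros Hu HF.
  assert (H1 := Cmod_triangle (q - RtoC F * u)%C (RtoC F * u)%C).
  assert (H2 := Cmod_triangle (RtoC F * u - q)%C q).
  rewrite Cmod_scal, Hu in H1 by easy.
  replace (q - RtoC F * u + RtoC F * u)%C with q in H1 by ring.
  replace (RtoC F * u - q + q)%C with (RtoC F * u)%C in H2 by ring.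
  rewrite Cmod_scal, Hu in H2 by easy.
  replace (RtoC F * u - q)%C with (- (q - RtoC F * u))%C in H2 by ring.
  rewrite Cmod_opp in H2. apply Rabs_le. lra.
Qed.

Lemma two_foci_equation (F k : R) (u q : C) :
  Cmod u = 1 ->
  ellipse (RtoC F * u)%C k q \/ hyperbola (RtoC F * u)%C k q ->
  (4 * k ^ 2 - F ^ 2 + 2 * F * dot u q) ^ 2 = (4 * k) ^ 2 * Cmod q ^ 2.
Proof.
  intros Hu H. assert (E := Cmod_sq_minus_axis F u q Hu).
  unfold ellipse, hyperbola in H. set (r := Cmod q) in *. set (r' := Cmod (q - _)%C) in *.
  assert (H' : r' ^ 2 = (r - 2 * k) ^ 2 \/ r' ^ 2 = (r + 2 * k) ^ 2).
  { destruct H as [H|H].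
    - left. replace r' with (2 * k - r) by lra. ring.
    - revert H. unfold Rabs. destruct (Rcase_abs _); intros H.
      + right. f_equal. lra.
      + left. f_equal. lra. }
  destruct H' as [H'|H'].
  - replace (4 * k ^ 2 - F ^ 2 + 2 * F * dot u q) with (4 * k * r) by lra. ring.
  - replace (4 * k ^ 2 - F ^ 2 + 2 * F * dot u q) with (- (4 * k * r)) by lra. ring.
Qed.

Lemma ellipse_equation (F k : R) (u q : C) :
  Cmod u = 1 -> 0 <= F < 2 * k ->
  ellipse (RtoC F * u)%C k q <-> 2 * k * Cmod q - F * dot u q = (4 * k ^ 2 - F ^ 2) / 2.
Proof.
  intros Hu HF. assert (E := Cmod_sq_minus_axis F u q Hu).
  assert (T := Cmod_minus_axis_ge F u q Hu (proj1 HF)). apply Rabs_le_between in T.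
  unfold ellipse. set (r := Cmod q) in *. set (r' := Cmod (q - _)%C) in *.
  split; intros H.
  - replace r' with (2 * k - r) in E by lra. lra.
  (* The second root would mean [r - r' = 2 * k], more than the focal distance [F]. *)
  - assert (Q : (r' - (2 * k - r)) * (r' + (2 * k - r)) = 0) by lra.
    apply Rmult_integral in Q as [Q|Q]; lra.
Qed.

Lemma hyperbola_equation (F k : R) (u q : C) :
  Cmod u = 1 -> 0 <= 2 * k < F ->
  hyperbola (RtoC F * u)%C k q <->
  F * dot u q - 2 * k * Cmod q = (F ^ 2 - 4 * k ^ 2) / 2 \/
  F * dot u q + 2 * k * Cmod q = (F ^ 2 - 4 * k ^ 2) / 2.
Proof.
  intros Hu HF. assert (E := Cmod_sq_minus_axis F u q Hu).
  assert (T := Cmod_minus_axis_ge F u q Hu ltac:(lra)). apply Rabs_le_between in T.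
  assert (R0 := Cmod_ge_0 q). assert (R1 := Cmod_ge_0 (q - RtoC F * u)%C).
  unfold hyperbola. set (r := Cmod q) in *. set (r' := Cmod (q - _)%C) in *.
  split.
  - unfold Rabs. destruct (Rcase_abs _); intros H; [right|left].
    + replace r' with (r + 2 * k) in E by lra. lra.
    + replace r' with (r - 2 * k) in E by lra. lra.
  - intros [H|H].
    (* The second root would mean [r + r' = 2 * k], less than the focal distance [F]. *)
    + assert (Q : (r' - (r - 2 * k)) * (r' + (r - 2 * k)) = 0) by lra.
      apply Rmult_integral in Q as [Q|Q]; [|lra].
      rewrite Rabs_pos_eq; lra.
    + assert (Q : (r' - (r + 2 * k)) * (r' + (r + 2 * k)) = 0) by lra.
      apply Rmult_integral in Q as [Q|Q].
      * rewrite Rabs_left1; lra.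
      * rewrite Rabs_left1; lra.
Qed.

Lemma ellipse_corresponds (F k : R) (u : C) :
  Cmod u = 1 -> 0 <= F < 2 * k -> corresponds (ellipse (RtoC F * u)%C k) (F / 2) u.
Proof.
  intros Hu HF. destruct (unit_sqrt u Hu) as (v & Hv & <-).
  (* Chosen so that [a ^ 2 + b ^ 2 = 2 * k] and [a ^ 2 - b ^ 2 = F], matching the two affine
     equations. *)
  set (a := sqrt ((2 * k + F) / 2)). set (b := sqrt ((2 * k - F) / 2)).
  assert (Ha : a ^ 2 = (2 * k + F) / 2) by (apply pow2_sqrt; lra).
  assert (Hb : b ^ 2 = (2 * k - F) / 2) by (apply pow2_sqrt; lra).
  assert (Hab : 0 < b <= a) by (split; [apply sqrt_lt_R0; lra|apply sqrt_le_1_alt; lra]).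
  replace (F / 2) with (a ^ 2 * ellipse_ecc a b ^ 2 / 2) by (rewrite ellipse_ecc_sq, Ha, Hb by easy; field).
  apply corresponds_ellipse; try easy.
  intros q. rewrite ellipse_equation, square_image_ellipse, Rmult_assoc, Ha, Hb by (auto; lra).
  split; intros H; lra.
Qed.

Lemma hyperbola_corresponds (F k : R) (u : C) :
  Cmod u = 1 -> 0 <= 2 * k < F -> corresponds (hyperbola (RtoC F * u)%C k) (F / 2) u.
Proof.
  intros Hu HF. destruct (unit_sqrt u Hu) as (v & Hv & <-).
  (* Here [a ^ 2 + b ^ 2 = F] and [a ^ 2 - b ^ 2 = 2 * k]. *)
  set (a := sqrt ((F + 2 * k) / 2)). set (b := sqrt ((F - 2 * k) / 2)).
  assert (Ha : a ^ 2 = (F + 2 * k) / 2) by (apply pow2_sqrt; lra).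
  assert (Hb : b ^ 2 = (F - 2 * k) / 2) by (apply pow2_sqrt; lra).
  assert (Ha0 : 0 < a) by (apply sqrt_lt_R0; lra).
  assert (Hb0 : 0 < b) by (apply sqrt_lt_R0; lra).
  replace (F / 2) with (a ^ 2 * hyperbola_ecc a b ^ 2 / 2) by (rewrite hyperbola_ecc_sq, Ha, Hb by easy; field).
  apply corresponds_hyperbola; try easy.
  intros q. rewrite hyperbola_equation, !square_image_hyperbola, !Rmult_assoc, Ha, Hb by (auto; lra).
  split; (intros [H|H]; [left|right]; lra).
Qed.

(* A line is the image of an equilateral hyperbola, or of its asymptotes when
   it passes through the origin. *)
Lemma line_corresponds (u : C) (d : R) : Cmod u = 1 -> 0 <= d -> corresponds (line u d) d u.
Proof.
  intros Hu Hd. destruct (unit_sqrt u Hu) as (v & Hv & <-). unfold line.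
  destruct (Req_dec d 0) as [->|Hd0].
  - apply corresponds_asymptotes with 1 1; try easy; try lra.
    intros q. rewrite square_image_asymptotes by (auto; lra). split; intros H; lra.
  - assert (Ha : sqrt d ^ 2 = d) by (apply pow2_sqrt; lra).
    assert (Ha0 : 0 < sqrt d) by (apply sqrt_lt_R0; lra).
    assert (E : d = sqrt d ^ 2 * hyperbola_ecc (sqrt d) (sqrt d) ^ 2 / 2)
      by (rewrite hyperbola_ecc_sq, Ha by easy; field).
    enough (H : corresponds (fun q => dot (v * v)%C q = d)
      (sqrt d ^ 2 * hyperbola_ecc (sqrt d) (sqrt d) ^ 2 / 2) (v * v)%C) by now rewrite <- E in H.
    apply corresponds_branch; try easy.
    intros q. rewrite square_image_hyperbola, !Rmult_assoc, Ha by (auto; lra).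
    split; intros H; [rewrite H; ring|].
    apply Rmult_eq_reg_l with (2 * d); lra.
Qed.

(** * The first integral of each kind of wall *)

Lemma A_first_integral (s e0 ta : R) (u : C) (B : C -> Prop) :
  s <> 0 -> Cmod u = 1 -> reflective_wall B 1 (RtoC (- (2 * ta)) * u)%C ->
  additional_first_integral s e0 B (rotated u (A s ta)).
Proof.
  intros Hs Hu HB. rewrite rotated_A by easy. apply fint_first_integral; auto.
Qed.

Lemma laplace_first_integral (s e0 d : R) (u : C) :
  s <> 0 -> Cmod u = 1 ->
  additional_first_integral s e0 (parabola u d) (rotated u (laplace s)).
Proof.
  intros Hs Hu. rewrite rotated_laplace by easy. apply fint_first_integral; auto.
  - right. apply Cmod_gt_0. lra.
  - now apply parabola_reflective_wall.
Qed.

Lemma two_foci_first_integral (s e0 F k : R) (u : C) (B : C -> Prop) :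
  s <> 0 -> Cmod u = 1 -> F <> 0 \/ k <> 0 ->
  (forall q, B q -> ellipse (RtoC F * u)%C k q \/ hyperbola (RtoC F * u)%C k q) ->
  additional_first_integral s e0 B (rotated u (A s (F / 2))).
Proof.
  intros Hs Hu HF HB. apply A_first_integral; auto.
  replace (2 * (F / 2)) with F by field.
  apply two_foci_reflective_wall with k; auto.
  intros q Hq. apply two_foci_equation; auto.
Qed.

Theorem theorem4 (s : R) (hs : s <> 0) :
  (forall B : C -> Prop,
     focused_conic B -> integrable_reflection_wall s B) /\
  (forall (B : C -> Prop) (ta : R) (u : C),
     corresponds B ta u ->
     forall e0 : R, additional_first_integral s e0 B (rotated u (A s ta))) /\
  (* parabolas: the limit of [A / (- 2 * ta)] as [ta] tends to infinity *)
  (forall (u : C) (d : R),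
     Cmod u = 1 ->
     forall e0 : R,
       additional_first_integral s e0 (parabola u d) (rotated u (laplace s))) /\
  (* ellipses *)
  (forall (f u : C) (k : R),
     0 < k -> Cmod f <= 2 * k -> Cmod u = 1 -> f = (Cmod f * u)%C ->
     (forall e0 : R,
        additional_first_integral s e0 (ellipse f k)
          (rotated u (A s (Cmod f / 2)))) /\
     (Cmod f < 2 * k -> corresponds (ellipse f k) (Cmod f / 2) u)) /\
  (* hyperbolas *)
  (forall (f u : C) (k : R),
     f <> RtoC 0 -> 0 <= 2 * k <= Cmod f -> Cmod u = 1 -> f = (Cmod f * u)%C ->
     (forall e0 : R,
        additional_first_integral s e0 (hyperbola f k)
          (rotated u (A s (Cmod f / 2)))) /\
     (2 * k < Cmod f -> corresponds (hyperbola f k) (Cmod f / 2) u)) /\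
  (* lines *)
  (forall (u : C) (d : R),
     Cmod u = 1 -> 0 <= d -> corresponds (line u d) d u).
Proof.
  assert (HE : forall (f u : C) (k e0 : R), 0 < k -> Cmod u = 1 -> f = (Cmod f * u)%C ->
    additional_first_integral s e0 (ellipse f k) (rotated u (A s (Cmod f / 2)))).
  { intros f u k e0 Hk Hu Hf. apply two_foci_first_integral with k; auto.
    - right; lra.
    - rewrite <- Hf. auto. }
  assert (HH : forall (f u : C) (k e0 : R), f <> RtoC 0 -> Cmod u = 1 -> f = (Cmod f * u)%C ->
    additional_first_integral s e0 (hyperbola f k) (rotated u (A s (Cmod f / 2)))).
  { intros f u k e0 Hk Hu Hf. apply two_foci_first_integral with k; auto.
    - left. apply Cmod_gt_0 in Hk. lra.
    - rewrite <- Hf. auto. }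
  split; [|split; [|split; [|split; [|split]]]].
  - intros B [u d Hu | f k Hk _ | f k Hf _ | u d Hu | u w Hu Hw] e0.
    + eexists. now apply laplace_first_integral.
    (* For a circle, [f = 0], the direction [u] is arbitrary. *)
    + destruct (unit_direction f) as (u & Hu & Hfu). eexists. now apply (HE f u).
    + destruct (unit_direction f) as (u & Hu & Hfu). eexists. now apply (HH f u).
    (* Here [d] may be negative, so the reflection property is used directly instead of
       [line_corresponds]. *)
    + eexists. apply (A_first_integral s e0 d u); auto. now apply line_reflective_wall.
    (* With both foci merged at the origin the integral is the squared angular momentum. *)
    + exists (fint s 1 (RtoC 0)). apply fint_first_integral; auto.
      now apply line_pair_reflective_wall.
  - intros B ta u H e0. apply A_first_integral; auto.
    + now apply corresponds_unit in H.
    + now apply corresponds_reflective_wall.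
  - intros u d Hu e0. now apply laplace_first_integral.
  - intros f u k Hk _ Hu Hf. split; [auto|]. intros Hlt.
    rewrite Hf at 1. apply ellipse_corresponds; auto. split; [apply Cmod_ge_0|easy].
  - intros f u k Hf Hk Hu Hfu. split; [auto|]. intros Hlt.
    rewrite Hfu at 1. apply hyperbola_corresponds; auto. lra.
  - intros u d Hu Hd. now apply line_corresponds.
Qed.
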